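(* Let $K/\mathbb{Q}$ be a cyclic extension of degree $n = q_1^{e_1}\cdots q_r^{e_r}$ (prime factorization, $q_i$ distinct primes), and let $\ell$ be a prime number not dividing $n$. For each $i$ let $s_i$ be the multiplicative order of $\ell$ modulo $q_i$, and put $s = \min\{s_1,\dots,s_r\}$. If $\ell$ divides the class number $h_K$, then $C\ell(K)[\ell] = \{[\mathfrak{a}] \in C\ell(K) : [\mathfrak{a}]^\ell = 1\}$ contains a subgroup isomorphic to $(\mathbb{Z}/\ell\mathbb{Z})^s$.
   Context: $C\ell(K)$ denotes the ideal class group of $K$ and $h_K$ its order. *)

(* Defs.v *)
From HB Require Import structures.
From mathcomp Require Import all_boot all_order all_algebra all_fingroup.
From mathcomp Require Import all_solvable all_field.
From mathcomp Require Import boolp classical_sets functions cardinality.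

Set Implicit Arguments.
Unset Strict Implicit.
Unset Printing Implicit Defensive.

Import GRing.Theory.

Local Open Scope ring_scope.
Local Open Scope classical_set_scope.
Local Open Scope quotient_scope.

Section FractionalIdeals.
Variable K : fieldExtType rat.

Definition ring_of_integers : set K :=
  [set x | integralOver (intr : int -> K) x].

Local Notation O := ring_of_integers.

Definition fractional_ideal (I : set K) : Prop :=
  [/\ I 0,
      forall x y, I x -> I y -> I (x + y),
      forall a x, O a -> I x -> I (a * x),
      exists2 x, I x & x != 0
    & exists d, [/\ O d, d != 0 & forall x, I x -> O (d * x)]].

Definition ideal_mul (I J : set K) : set K :=
  [set x | exists2 s : seq (K * K),
     forall p, p \in s -> I p.1 /\ J p.2 & x = \sum_(p <- s) p.1 * p.2].

(* The ring of integers is a Dedekind domain, so every fractional ideal is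
   invertible. The class group below is defined as the quotient of the group of
   invertible fractional ideals, which makes its group laws elementary. *)
Definition invertible_ideal (I : set K) : Prop :=
  fractional_ideal I /\
  exists2 J, fractional_ideal J & ideal_mul I J = O.

Definition ideal_scale (a : K) (I : set K) : set K := [set a * x | x in I].

Lemma integers0 : O 0. Proof. exact: integral0. Qed.
Lemma integers1 : O 1. Proof. exact: integral1. Qed.

Lemma integersD x y : O x -> O y -> O (x + y).
Proof. exact: integral_add. Qed.

Lemma integersM x y : O x -> O y -> O (x * y).
Proof. exact: integral_mul. Qed.

Lemma fractional_integers : fractional_ideal O.
Proof.
split; [exact: integers0|exact: integersD|exact: integersM| |].
  by exists 1; [exact: integers1|exact: oner_neq0].
exists 1; split; [exact: integers1|exact: oner_neq0|].
by move=> x Ox; rewrite mul1r.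
Qed.

Lemma ideal_mul_gen (I J : set K) x y : I x -> J y -> ideal_mul I J (x * y).
Proof.
move=> Ix Jy; exists [:: (x, y)]; last by rewrite big_seq1.
by move=> p; rewrite inE => /eqP ->.
Qed.

Lemma ideal_mul_sub (I J L : set K) :
  L 0 -> (forall x y, L x -> L y -> L (x + y)) ->
  (forall x y, I x -> J y -> L (x * y)) -> ideal_mul I J `<=` L.
Proof.
move=> L0 LD LIJ _ [s sIJ ->]; rewrite big_seq.
apply: (big_ind L) => // p /sIJ [Ip Jp]; exact: LIJ.
Qed.

Lemma ideal_mul0 (I J : set K) : ideal_mul I J 0.
Proof. by exists [::]; rewrite ?big_nil. Qed.

Lemma ideal_mulD (I J : set K) x y :
  ideal_mul I J x -> ideal_mul I J y -> ideal_mul I J (x + y).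
Proof.
move=> [s sP ->] [t tP ->]; exists (s ++ t); last by rewrite big_cat.
by move=> p; rewrite mem_cat => /orP[/sP|/tP].
Qed.

Lemma ideal_mulC (I J : set K) : ideal_mul I J = ideal_mul J I.
Proof.
rewrite eqEsubset; split; apply: ideal_mul_sub;
  by [exact: ideal_mul0|exact: ideal_mulD
     |move=> x y ? ?; rewrite mulrC; exact: ideal_mul_gen].
Qed.

Lemma ideal_mulA (I J L : set K) :
  ideal_mul I (ideal_mul J L) = ideal_mul (ideal_mul I J) L.
Proof.
have sub (A B C : set K) :
    ideal_mul A (ideal_mul B C) `<=` ideal_mul (ideal_mul A B) C.
  apply: ideal_mul_sub; [exact: ideal_mul0|exact: ideal_mulD|].
  move=> x y Ax [s sP ->]; rewrite mulr_sumr big_seq.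
  apply: (big_ind (ideal_mul (ideal_mul A B) C));
    [exact: ideal_mul0|exact: ideal_mulD|move=> p /sP[Bp Cp]].
  by rewrite mulrA; apply: ideal_mul_gen => //; apply: ideal_mul_gen.
rewrite eqEsubset; split; first exact: sub.
rewrite ideal_mulC (ideal_mulC I J) (ideal_mulC I) (ideal_mulC J L).
exact: sub.
Qed.

Lemma ideal_mul1 (I : set K) : fractional_ideal I -> ideal_mul O I = I.
Proof.
move=> [I0 ID IZ _ _]; rewrite eqEsubset; split.
  by apply: ideal_mul_sub => // x y; apply: IZ.
by move=> x Ix; rewrite -[x]mul1r; apply: ideal_mul_gen => //;
  exact: integers1.
Qed.

Lemma fractional_mul (I J : set K) :
  fractional_ideal I -> fractional_ideal J -> fractional_ideal (ideal_mul I J).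
Proof.
move=> [I0 ID IZ [x Ix x0] [d [Od d0 dI]]].
move=> [J0 JD JZ [y Jy y0] [e [Oe e0 eJ]]].
split; [exact: ideal_mul0|exact: ideal_mulD| | |].
- move=> a _ Oa [s sP ->]; rewrite mulr_sumr big_seq.
  apply: (big_ind (ideal_mul I J));
    [exact: ideal_mul0|exact: ideal_mulD|move=> p /sP[Ip Jp]].
  by rewrite mulrA; apply: ideal_mul_gen => //; apply: IZ.
- by exists (x * y); [exact: ideal_mul_gen|rewrite mulf_neq0].
- exists (d * e); split; [exact: integersM|by rewrite mulf_neq0|].
  move=> _ [s sP ->]; rewrite mulr_sumr big_seq.
  apply: (big_ind O); [exact: integers0|exact: integersD|move=> p /sP[Ip Jp]].
  by rewrite mulrACA; apply: integersM; [exact: dI|exact: eJ].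
Qed.

Lemma invertible_integers : invertible_ideal O.
Proof.
split; first exact: fractional_integers.
by exists O; [|apply: ideal_mul1]; exact: fractional_integers.
Qed.

Lemma invertible_mul (I J : set K) :
  invertible_ideal I -> invertible_ideal J -> invertible_ideal (ideal_mul I J).
Proof.
move=> [fI [I' fI' II']] [fJ [J' fJ' JJ']].
split; first exact: fractional_mul.
exists (ideal_mul I' J'); first exact: fractional_mul.
rewrite ideal_mulA (ideal_mulC _ I') ideal_mulA (ideal_mulC I') II'.
by rewrite ideal_mul1.
Qed.

(* (O : I), the inverse of I when I is invertible. *)
Definition ideal_inv (I : set K) : set K :=
  [set x | forall y, I y -> O (x * y)].

Lemma ideal_invE (I J : set K) : fractional_ideal J ->
  ideal_mul I J = O -> ideal_inv I = J.
Proof.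
move=> [J0 JD JZ _ _] IJ; rewrite eqEsubset; split => [x Ix|x Jx y Iy].
  have [s sP s1] : ideal_mul I J 1 by rewrite IJ; exact: integers1.
  rewrite -[x]mulr1 s1 mulr_sumr big_seq.
  apply: (big_ind J) => // p /sP[Ip Jp].
  by rewrite mulrA; apply: JZ => //; apply: Ix.
by rewrite -IJ mulrC; apply: ideal_mul_gen.
Qed.

Lemma ideal_mulV (I : set K) :
  invertible_ideal I -> ideal_mul (ideal_inv I) I = O.
Proof. by move=> [_ [J fJ IJ]]; rewrite (ideal_invE fJ IJ) ideal_mulC. Qed.

Lemma invertible_inv (I : set K) :
  invertible_ideal I -> invertible_ideal (ideal_inv I).
Proof.
move=> [fI [J fJ IJ]]; rewrite (ideal_invE fJ IJ).
by split=> //; exists I; rewrite // ideal_mulC.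
Qed.

Record ideal_group := IdealGroup {
  ideal_set :> set K;
  _ : `[< invertible_ideal ideal_set >] }.

HB.instance Definition _ := [isSub for ideal_set].
HB.instance Definition _ := [Choice of ideal_group by <:].

Lemma ideal_groupP (I : ideal_group) : invertible_ideal I.
Proof. by apply/asboolP; case: I. Qed.

Definition ideal_group_one : ideal_group :=
  IdealGroup (asboolT invertible_integers).

Definition ideal_group_mul (I J : ideal_group) : ideal_group :=
  IdealGroup (asboolT (invertible_mul (ideal_groupP I) (ideal_groupP J))).

Definition ideal_group_inv (I : ideal_group) : ideal_group :=
  IdealGroup (asboolT (invertible_inv (ideal_groupP I))).

Lemma ideal_group_mulC : commutative ideal_group_mul.
Proof. by move=> I J; apply: val_inj; apply: ideal_mulC. Qed.

Lemma ideal_group_mulA : associative ideal_group_mul.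
Proof. by move=> I J L; apply: val_inj; apply: ideal_mulA. Qed.

Lemma ideal_group_mul1 : left_id ideal_group_one ideal_group_mul.
Proof.
by move=> I; apply: val_inj; apply: ideal_mul1; case: (ideal_groupP I).
Qed.

Lemma ideal_group_mul1r : right_id ideal_group_one ideal_group_mul.
Proof. by move=> I; rewrite ideal_group_mulC ideal_group_mul1. Qed.

Lemma ideal_group_mulV :
  left_inverse ideal_group_one ideal_group_inv ideal_group_mul.
Proof.
by move=> I; apply: val_inj; apply: ideal_mulV; apply: ideal_groupP.
Qed.

Lemma ideal_group_mulVr :
  right_inverse ideal_group_one ideal_group_inv ideal_group_mul.
Proof. by move=> I; rewrite ideal_group_mulC ideal_group_mulV. Qed.

HB.instance Definition _ := isGroup.Build ideal_group
  ideal_group_mulA ideal_group_mul1 ideal_group_mul1r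
  ideal_group_mulV ideal_group_mulVr.

(* I and J differ by a principal ideal (a) : I J^-1 = (a) iff I = a J. *)
Definition ideal_equiv (I J : ideal_group) : bool :=
  `[< exists2 a : K, a != 0 & ideal_set I = ideal_scale a J >].

Lemma ideal_scaleA a b (I : set K) :
  ideal_scale a (ideal_scale b I) = ideal_scale (a * b) I.
Proof.
rewrite eqEsubset; split=> x.
  by move=> [_ [y Iy <-] <-]; exists y; rewrite ?mulrA.
by move=> [y Iy <-]; exists (b * y); [exists y|rewrite mulrA].
Qed.

Lemma ideal_scale1 (I : set K) : ideal_scale 1 I = I.
Proof.
rewrite eqEsubset; split=> x; first by move=> [y Iy <-]; rewrite mul1r.
by move=> Ix; exists x; rewrite ?mul1r.
Qed.

Lemma ideal_scale_mul a (I J : set K) :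
  ideal_mul (ideal_scale a I) J = ideal_scale a (ideal_mul I J).
Proof.
rewrite eqEsubset; split.
  apply: ideal_mul_sub.
  - by exists 0; [exact: ideal_mul0|rewrite mulr0].
  - move=> _ _ [x Ix <-] [y Iy <-]; exists (x + y); last by rewrite mulrDr.
    exact: ideal_mulD.
  - move=> _ y [x Ix <-] Jy; exists (x * y); last by rewrite mulrA.
    exact: ideal_mul_gen.
move=> _ [_ [s sP ->] <-]; rewrite mulr_sumr big_seq.
apply: (big_ind (ideal_mul (ideal_scale a I) J));
  [exact: ideal_mul0|exact: ideal_mulD|move=> p /sP[Ip Jp]].
by rewrite mulrA; apply: ideal_mul_gen => //; exists p.1.
Qed.

Lemma ideal_equiv_refl : reflexive ideal_equiv.
Proof.
move=> I; apply/asboolP; exists 1; first exact: oner_neq0.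
by rewrite ideal_scale1.
Qed.

Lemma ideal_equiv_sym : symmetric ideal_equiv.
Proof.
suff sub I J : ideal_equiv I J -> ideal_equiv J I.
  by move=> I J; apply/idP/idP; apply: sub.
move=> /asboolP[a a0 IJ]; apply/asboolP; exists a^-1; first by rewrite invr_eq0.
by rewrite IJ ideal_scaleA mulVf // ideal_scale1.
Qed.

Lemma ideal_equiv_trans : transitive ideal_equiv.
Proof.
move=> J I L /asboolP[a a0 IJ] /asboolP[b b0 JL]; apply/asboolP.
by exists (a * b); rewrite ?mulf_neq0 // IJ JL ideal_scaleA.
Qed.

Canonical ideal_equiv_rel :=
  EquivRel ideal_equiv ideal_equiv_refl ideal_equiv_sym ideal_equiv_trans.

Definition class_group : Type := {eq_quot ideal_equiv}.

HB.instance Definition _ := Choice.on class_group.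
HB.instance Definition _ := EqQuotient.on class_group.

Definition ideal_class (I : ideal_group) : class_group := \pi_class_group I.

Lemma ideal_class_eq (I J : ideal_group) :
  (ideal_class I = ideal_class J) <->
  exists2 a : K, a != 0 & ideal_set I = ideal_scale a J.
Proof.
by split=> [/eqmodP /asboolP //|IJ]; apply/eqmodP/asboolP.
Qed.

Definition class_mul (c d : class_group) : class_group :=
  ideal_class (generic_quotient.repr c * generic_quotient.repr d)%g.

Definition class_inv (c : class_group) : class_group :=
  ideal_class (generic_quotient.repr c)^-1%g.

Lemma class_mulE (I J : ideal_group) :
  class_mul (ideal_class I) (ideal_class J) = ideal_class (I * J)%g.
Proof.
have mull (A B C : ideal_group) : ideal_class A = ideal_class B ->
    ideal_class (A * C)%g = ideal_class (B * C)%g.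
  move=> /ideal_class_eq[a a0 AB]; apply/ideal_class_eq; exists a => //.
  by rewrite /= AB ideal_scale_mul.
have reprE A : ideal_class (generic_quotient.repr (ideal_class A)) = ideal_class A.
  exact: reprK.
rewrite /class_mul (mull _ _ _ (reprE I)).
rewrite -[(I * _)%g]/(ideal_group_mul _ _) ideal_group_mulC.
rewrite (mull _ _ _ (reprE J)).
by rewrite -[(J * _)%g]/(ideal_group_mul _ _) ideal_group_mulC.
Qed.

Lemma ideal_classK (c : class_group) : ideal_class (generic_quotient.repr c) = c.
Proof. exact: reprK. Qed.

Lemma class_mulC : commutative class_mul.
Proof.
move=> c d; rewrite /class_mul.
by rewrite -[(generic_quotient.repr c * _)%g]/(ideal_group_mul _ _) ideal_group_mulC.
Qed.

Lemma class_mulA : associative class_mul.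
Proof.
move=> c d e; rewrite -(ideal_classK c) -(ideal_classK d) -(ideal_classK e).
by rewrite !class_mulE mulgA.
Qed.

Lemma class_mul1 : left_id (ideal_class 1%g) class_mul.
Proof. by move=> c; rewrite -(ideal_classK c) class_mulE mul1g. Qed.

Lemma class_mul1r : right_id (ideal_class 1%g) class_mul.
Proof. by move=> c; rewrite class_mulC class_mul1. Qed.

Lemma class_mulV : left_inverse (ideal_class 1%g) class_inv class_mul.
Proof.
by move=> c; rewrite -{2}(ideal_classK c) class_mulE mulVg.
Qed.

Lemma class_mulVr : right_inverse (ideal_class 1%g) class_inv class_mul.
Proof. by move=> c; rewrite class_mulC class_mulV. Qed.

HB.instance Definition _ := isGroup.Build class_group
  class_mulA class_mul1 class_mul1r class_mulV class_mulVr.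

Definition has_class_number (h : nat) : Prop :=
  ([set: class_group] #= `I_h)%card.

End FractionalIdeals.

Section Subgroups.
Variable G : groupType.

Definition torsion (m : nat) : set G := [set c | c ^+ m = 1]%g.

Definition is_subgroup (H : set G) : Prop :=
  H 1%g /\ forall x y, H x -> H y -> H (x * y^-1)%g.

Definition isomorphic_to_additive (H : set G) (A : zmodType) : Prop :=
  exists2 f : A -> G,
    forall x y, f (x + y) = (f x * f y)%g & set_bij [set: A] H f.

End Subgroups.

Arguments torsion G m : clear implicits.

(* insubd maps a to the corresponding unit of Z/m, so this is the order of a
   modulo m when m > 1 and a is prime to m, the only case of interest. *)
Definition mult_order (a m : nat) : nat :=
  #[insubd (1%g : {unit 'Z_m}) (a%:R : 'Z_m)]%g.

(* Every order involved is < n, so that the default value n only matters for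
   n = 1, when the minimum is over the empty set. *)
Definition min_mult_order (a n : nat) : nat :=
  \big[minn/n]_(q <- primes n) mult_order a q.

(* Main.v *)
(** A generator sigma of the Galois group acts on the class group. If I is an
    invertible ideal and f a polynomial whose coefficients generate I, then by
    Dedekind's Prague theorem the product of the conjugates of I is the content
    ideal of the product of the conjugates of f, a polynomial with rational
    coefficients; it is thus generated by a rational number. So a class fixed
    by sigma is killed by n, and as l does not divide n, sigma fixes no
    nontrivial class of the l-torsion E. Choose m minimal such that sigma^m
    fixes a nontrivial element of E, let B be its group of fixed points and
    let q be a prime divisor of m. Then sigma^(m/q) acts on B with order q and
    only one fixed point, so |B| = l^d is 1 modulo q, and the order of l modulo
    q divides d > 0. *)

Require Import Defs.
From HB Require Import structures.
From mathcomp Require Import all_boot all_order all_algebra all_fingroup.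
From mathcomp Require Import all_solvable all_field.
From mathcomp Require Import mxabelem.
From mathcomp Require Import boolp classical_sets functions cardinality.

Set Implicit Arguments.
Unset Strict Implicit.
Unset Printing Implicit Defensive.

Import GRing.Theory.

Local Open Scope ring_scope.
Local Open Scope classical_set_scope.

(** * Integrality of products of coefficients *)

Section IntegralProducts.
Variables (R : comNzRingType) (L : fieldType) (iota : {rmorphism R -> L}).

Local Notation integral := (integralOver iota).
Definition integral_coefs (p : {poly L}) := forall i, integral p`_i.

Lemma integral_coefsD (p q : {poly L}) :
  integral_coefs p -> integral_coefs q -> integral_coefs (p + q).
Proof. by move=> ip iq i; rewrite coefD; apply: integral_add. Qed.

Lemma integral_coefsN (p : {poly L}) :
  integral_coefs p -> integral_coefs (- p).
Proof. by move=> ip i; rewrite coefN; apply: integral_opp. Qed.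

Lemma integral_coefs_monomial (a : L) n :
  integral a -> integral_coefs (a *: 'X^n).
Proof.
move=> ia i; rewrite coefZ coefXn; apply: integral_mul => //.
exact: integral_nat.
Qed.

Lemma integralX (a : L) n : integral a -> integral (a ^+ n).
Proof.
move=> ia; elim: n => [|n IHn]; first exact: integral1.
by rewrite exprS; apply: integral_mul.
Qed.

(* With c the leading coefficient and n the degree, c r is a root of the monic
   polynomial c^(n-1) p(X / c). *)
Lemma integral_lead_coef_mul_root (p : {poly L}) (r : L) :
  integral_coefs p -> root p r -> integral (lead_coef p * r).
Proof.
move=> ip pr; set c := lead_coef p.
have [sp|sp] := leqP (size p) 1.
  have [p0|/negP p0] := eqVneq p 0.
    by rewrite /c p0 lead_coef0 mul0r; apply: integral0.
  move: pr; rewrite [p]size1_polyC // rootC => /eqP p00.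
  by case: p0; rewrite [p]size1_polyC // p00 polyC0.
case def_n: (size p) => [|[|n]]; rewrite def_n // in sp.
pose q : {poly L} := 'X^(n.+1) + \poly_(i < n.+1) (p`_i * c ^+ (n - i)).
have sq : (size (\poly_(i < n.+1) (p`_i * c ^+ (n - i)))%R
           < size ('X^(n.+1) : {poly L})%R)%N.
  by rewrite size_polyXn ltnS; apply: size_poly.
apply: (@integral_root_monic _ _ iota _ q).
- by rewrite monicE /q lead_coefDl // lead_coefXn.
- move: pr; rewrite /root horner_coef def_n big_ord_recr /= => /eqP pr.
  rewrite /q hornerD hornerXn horner_poly.
  suff -> : (c * r) ^+ n.+1 +
      \sum_(i < n.+1) p`_i * c ^+ (n - i) * (c * r) ^+ i =
      c ^+ n * (\sum_(i < n.+1) p`_i * r ^+ i + p`_n.+1 * r ^+ n.+1).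
    by rewrite pr mulr0.
  rewrite mulrDr mulr_sumr addrC; congr (_ + _).
    apply: eq_bigr => i _; have -> : c ^+ n = c ^+ (n - i) * c ^+ i.
      by rewrite -exprD subnK // -ltnS.
    by rewrite exprMn [RHS]mulrCA !mulrA.
  by rewrite exprMn exprSr /c lead_coefE def_n /= mulrA.
- apply/integral_poly; apply: integral_coefsD => i.
    by rewrite coefXn; apply: integral_nat.
  rewrite coef_poly; case: ifP => _; last exact: integral0.
  by apply: integral_mul => //; apply: integralX; apply: ip.
Qed.

(** The leading coefficient [c] of [p] is also that of the product, and [r] is a root of the
    product, so [c] and [c * r] are integral. Hence the leading term of [p] can be removed, and
    induction on the size applies. *)
Lemma integral_coefs_divXsubC (p : {poly L}) (r : L) :
  integral_coefs (p * ('X - r%:P)) -> integral_coefs p.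
Proof.
have [m] := ubnP (size p); elim: m p => // m IHm p /ltnSE sp ip.
have [->|p0] := eqVneq p 0; first by move=> i; rewrite coef0; apply: integral0.
set c := lead_coef p.
have lc : lead_coef (p * ('X - r%:P)) = c.
  by rewrite lead_coefM lead_coefXsubC mulr1.
have ic : integral c by rewrite -lc lead_coefE.
have icr : integral (c * r).
  rewrite -lc; apply: integral_lead_coef_mul_root => //.
  by rewrite rootM root_XsubC eqxx orbT.
pose k := (size p).-1; pose p' := p - c *: 'X^k.
have -> : p = p' + c *: 'X^k by rewrite subrK.
apply: integral_coefsD; last exact: integral_coefs_monomial.
apply: IHm.
  have spE : size p = k.+1 by rewrite /k prednK // lt0n size_poly_eq0.
  apply: leq_trans sp; rewrite spE ltnS; apply/leq_sizeP => j kj.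
  rewrite coefB coefZ coefXn; move: kj; rewrite leq_eqVlt => /predU1P[<-|kj].
    by rewrite eqxx mulr1 -lead_coefE subrr.
  by rewrite nth_default ?spE // gtn_eqF // mulr0 subr0.
have -> : p' * ('X - r%:P) =
    p * ('X - r%:P) + (- (c *: 'X^(k.+1)) + (c * r) *: 'X^k).
  rewrite mulrBl; congr (_ + _).
  by rewrite -scalerAl mulrBr -exprSr mulrC mul_polyC scalerBr opprB
    addrC scalerA.
by do !apply: integral_coefsD => //; rewrite -?scaleNr;
  apply: integral_coefs_monomial => //; apply: integral_opp.
Qed.

(** If [f (X - r) g] has integral coefficients, so do [f g] and [r f g = X f g - f (X - r) g]. The
    induction hypothesis thus serves for both [f] and [r f]. *)
Lemma integral_coefM_split (f : {poly L}) (rs : seq L) :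
  integral_coefs (f * \prod_(r <- rs) ('X - r%:P)) ->
  forall i j, integral (f`_i * (\prod_(r <- rs) ('X - r%:P))`_j).
Proof.
elim: rs f => [|r rs IHrs] f.
  rewrite !big_nil mulr1 => iF i j; rewrite coef1.
  by apply: integral_mul => //; apply: integral_nat.
rewrite big_cons; set g := \prod_(r <- rs) _ => iF i j.
have iFg : integral_coefs (f * g).
  by apply: (@integral_coefs_divXsubC _ r); rewrite -mulrA [g * _]mulrC.
have irFg : integral_coefs ((r *: f) * g).
  have -> : (r *: f) * g = (f * g) * 'X + - (f * (('X - r%:P) * g)).
    rewrite mulrBl mulrBr opprB mul_polyC -scalerAr ['X * g]mulrC mulrA.
    by rewrite addrC subrK scalerAl.
  apply: integral_coefsD; last exact: integral_coefsN.
  by move=> k; rewrite coefMX; case: k => [|k] /=; [apply: integral0|].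
(* The coefficient of index [j] in [(X - r) g] is [g_(j-1) - r g_j], with [g_(-1) = 0]. *)
rewrite mulrBl coefB coefXM mul_polyC coefZ mulrBr.
apply: integral_sub; last by rewrite mulrCA mulrA -(coefZ r f); apply: IHrs.
by case: eqP => _; [rewrite mulr0; apply: integral0|apply: IHrs].
Qed.

End IntegralProducts.

(** * Splitting extensions of an arbitrary field *)

Lemma root_extension (F : fieldType) (p : {poly F}) : (1 < size p)%N ->
  exists (L : fieldType) (f : {rmorphism F -> L}) (z : L),
    root (map_poly f p) z.
Proof.
have [m] := ubnP (size p); elim: m p => // m IHm p /ltnSE sp p1.
have [irr_p|] := EM (irreducible_poly p).
  have [L _ [z rz _]] := irredp_FAdjoin irr_p.
  by exists L, (in_alg L), z.
(* If no extension has a root, [p] is irreducible: by induction a nonconstant divisor of smaller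
   degree would have a root in some extension, and this is a root of [p]. *)
move=> nirr; apply: contrapT => noroot; apply: nirr; split=> // q q1 qp.
rewrite -dvdp_size_eqp // eqn_leq dvdp_leq -?size_poly_gt0 ?(ltnW p1) //=.
rewrite leqNgt; apply/negP => ltqp; apply: noroot.
have q0 : q != 0.
  by apply: contraTneq qp => ->; rewrite dvd0p -size_poly_gt0 ltnW.
have [||L [f [z rz]]] := IHm q; first exact: leq_trans ltqp sp.
  by rewrite ltn_neqAle eq_sym q1 lt0n size_poly_eq0.
exists L, f, z; move: rz; rewrite !root_factor_theorem => /dvdp_trans; apply.
by rewrite dvdp_map.
Qed.

Lemma splitting_extension (F : fieldType) (p : {poly F}) :
  exists (L : fieldType) (f : {rmorphism F -> L}) (c : L) (rs : seq L),
    map_poly f p = c *: \prod_(r <- rs) ('X - r%:P).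
Proof.
have [m] := ubnP (size p); elim: m F p => // m IHm F p /ltnSE sp.
have [p1|p1] := leqP (size p) 1.
  exists F, idfun, p`_0, [::].
  by rewrite map_poly_id // big_nil [LHS]size1_polyC // alg_polyC.
have [L [f [z /factor_theorem[q pq]]]] := root_extension p1.
have p0 : p != 0 by rewrite -size_poly_gt0 ltnW.
have q0 : q != 0.
  by apply: contra_neq p0 => q0; apply/eqP;
    rewrite -(map_poly_eq0 f) pq q0 mul0r.
have [|L' [f' [c [rs qE]]]] := IHm L q.
  by apply: leq_trans sp; rewrite -(size_map_poly f) pq size_mul
    ?polyXsubC_eq0 // size_XsubC addn2.
exists L', (f' \o f), c, (f' z :: rs).
rewrite map_poly_comp pq rmorphM /= qE big_cons rmorphB /= map_polyX.
rewrite map_polyC /=.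
by rewrite -scalerAl mulrC.
Qed.

Lemma integral_inj (K L : fieldType) (f : {rmorphism K -> L}) (x : K) :
  integralOver (intr : int -> L) (f x) -> integralOver (intr : int -> K) x.
Proof.
move=> [p monp rp]; exists p => //.
rewrite -(fmorph_root f) -map_poly_comp.
by rewrite (eq_map_poly (g := intr)) // => a; apply: rmorph_int.
Qed.

(* Dedekind's Prague theorem: over an extension in which g splits, removing
   the roots of g one at a time keeps the coefficients integral. *)
Lemma integral_coefM (K : fieldType) (f g : {poly K}) :
  (forall i, integralOver (intr : int -> K) (f * g)`_i) ->
  forall i j, integralOver (intr : int -> K) (f`_i * g`_j).
Proof.
move=> ifg i j.
have [L [s [c [rs gE]]]] := splitting_extension g.
apply: (@integral_inj _ _ s).
(* The constant [c] is moved from [g] to [f], leaving a product of monic linear factors. *)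
rewrite rmorphM -2!coef_map /= gE coefZ mulrCA mulrA -(coefZ c (map_poly s f)).
apply: (integral_coefM_split (iota := intr)) => k.
rewrite -scalerAl scalerAr -gE -rmorphM coef_map /=.
have [p monp rp] := ifg k; exists p => //.
rewrite -(fmorph_root s) -map_poly_comp in rp.
by move: rp; rewrite (eq_map_poly (g := intr)) // => a; apply: rmorph_int.
Qed.

(** * Norms of ideals and the action on the class group *)

Section IdealNorm.
Variable K : fieldExtType rat.
Local Notation O := (@ring_of_integers K).

Definition integers_submodule (J : set K) : Prop :=
  [/\ J 0, forall x y, J x -> J y -> J (x + y)
    & forall a x, O a -> J x -> J (a * x)].

Lemma fractional_submodule (I : set K) :
  fractional_ideal I -> integers_submodule I.
Proof. by case. Qed.

Definition content_ideal (f : {poly K}) (I : set K) : Prop :=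
  (forall i, I f`_i) /\
  forall J, integers_submodule J -> (forall i, J f`_i) -> I `<=` J.

(** With [1] written as a sum of [a_k b_k], [a_k] in [I] and [b_k] in the inverse, each [x] in [I]
    is the sum of the [(x b_k) a_k]. So the [a_k] generate [I], and they serve as coefficients. *)
Lemma invertible_content (I : set K) : invertible_ideal I ->
  exists2 f : {poly K}, f != 0 & content_ideal f I.
Proof.
move=> [[I0 ID IZ [x0 Ix0 x0_neq0] _] [J fJ IJ]].
have [s sP s1] : ideal_mul I J 1 by rewrite IJ; exact: integers1.
have fc : content_ideal (Poly (map fst s)) I.
  split=> [i|M [M0 MD MZ] fM x Ix].
    rewrite coef_Poly; have [lti|gei] := ltnP i (size (map fst s)).
      by have /mapP[p /sP[Ip _] ->] := mem_nth 0 lti.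
    by rewrite nth_default.
  rewrite -[x]mulr1 s1 mulr_sumr big_seq; apply: big_ind => // p ps.
  have [Ip Jp] := sP _ ps.
  rewrite mulrCA mulrC; apply: MZ.
    by rewrite -IJ; exact: ideal_mul_gen.
  have /(nthP 0)[i _ <-] : p.1 \in map fst s by apply: map_f.
  by rewrite -coef_Poly.
exists (Poly (map fst s)) => //; apply: contra_neq x0_neq0 => f0.
have [_ /(_ [set 0])] := fc; apply => // [|i]; last by rewrite f0 coef0.
by split=> [//|x y -> ->|a x _ ->]; rewrite /= ?addr0 ?mulr0.
Qed.

Definition ideal_prod (s : seq (set K)) : set K := foldr (@ideal_mul K) O s.

Lemma coef_mul_ideal (I J : set K) (f g : {poly K}) :
  (forall i, I f`_i) -> (forall i, J g`_i) ->
  forall i, ideal_mul I J (f * g)`_i.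
Proof.
move=> fI gJ i; rewrite coefM.
apply: big_ind => [|x y|j _]; [exact: ideal_mul0|exact: ideal_mulD|].
exact: ideal_mul_gen.
Qed.

(** The constant [c] is arbitrary so that the induction can absorb into it a coefficient of the
    first polynomial, as [integral_coefM] permits. Minimality of the content then passes from the
    coefficients to all of [I]. *)
Lemma content_prod_sub (s : seq ({poly K} * set K)) (c : K) :
  (forall p, p \in s -> content_ideal p.1 p.2) ->
  (forall i, O (c *: \prod_(p <- s) p.1)`_i) ->
  forall x, ideal_prod (map snd s) x -> O (c * x).
Proof.
elim: s c => [|[f I] s IHs] c sP cO x /=.
  move=> Ox; apply: integersM => //.
  by have := cO 0%N; rewrite big_nil coefZ coef1 mulr1.
have [_ Imin] := sP _ (mem_head _ _); rewrite /= in Imin.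
pose L : set K := [set y | O (c * y)].
have LD y z : L y -> L z -> L (y + z).
  by rewrite /L /= mulrDr; apply: integersD.
have L0 : L 0 by rewrite /L /= mulr0; exact: integers0.
apply: (@ideal_mul_sub _ _ _ L) => // u v Iu Pv.
pose M : set K := [set w | O (c * (w * v))].
apply: (Imin M) Iu => [|i].
  split=> [|y z|a y Oa My]; rewrite /M /=.
  - by rewrite mul0r mulr0; exact: integers0.
  - by rewrite mulrDl mulrDr; apply: integersD.
  - by rewrite -mulrA mulrCA; apply: integersM.
rewrite /M /= mulrA; apply: IHs Pv => [p ps|j].
  by apply: sP; rewrite inE ps orbT.
rewrite coefZ -(coefZ c); apply: integral_coefM => k.
by have := cO k; rewrite big_cons -scalerAl.
Qed.

Lemma content_prod_coef (s : seq ({poly K} * set K)) :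
  (forall p, p \in s -> content_ideal p.1 p.2) ->
  forall i, ideal_prod (map snd s) (\prod_(p <- s) p.1)`_i.
Proof.
elim: s => [|p s IHs] sP i /=.
  by rewrite big_nil coef1; case: eqP => _; [exact: integers1|exact: integers0].
rewrite big_cons; apply: coef_mul_ideal => [j|].
  by have [+ _] := sP _ (mem_head _ _); apply.
by apply: IHs => q qs; apply: sP; rewrite inE qs orbT.
Qed.

Lemma fractional_prod (s : seq (set K)) :
  (forall I, I \in s -> fractional_ideal I) -> fractional_ideal (ideal_prod s).
Proof.
elim: s => [|I s IHs] sP /=; first exact: fractional_integers.
apply: fractional_mul; first exact: (sP _ (mem_head _ _)).
by apply: IHs => q qs; apply: sP; rewrite inE qs orbT.
Qed.

(** The content is, up to sign, the gcd of the coefficients, so Bezout's identity places it in every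
    ideal of the integers that contains them. *)
Lemma zcontents_mem (N : int -> Prop) (q : {poly int}) :
  N 0 -> (forall x y, N x -> N y -> N (x + y)) ->
  (forall a x, N x -> N (a * x)) -> (forall i, N q`_i) -> N (zcontents q).
Proof.
move=> N0 ND NM Nq; rewrite /zcontents; apply: (NM).
apply: (big_ind (fun k : nat => N k)) => // [x y Nx Ny|i _].
  have [u [v uv]] := Bezoutz x y.
  rewrite -[Posz _]/(gcdz x y) -uv; apply: (ND); exact: NM.
by rewrite abszEsign; apply: NM; apply: Nq.
Qed.

(** [F] is a rational number [c] times a primitive integer polynomial, and Bezout's identity makes
    [c] an integer combination of the coefficients of [F]. *)
Lemma rational_poly_content (F : {poly K}) (J : set K) :
  F != 0 -> (forall i, exists q : rat, F`_i = q%:A) ->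
  integers_submodule J -> (forall i, J F`_i) ->
  exists c, [/\ c != 0, J c & forall i, O (c^-1 *: F)`_i].
Proof.
move=> F0 ratF [J0 JD JZ] JF.
have [r rE] := choice ratF.
pose p := \poly_(i < size F) r i.
have FE : F = map_poly (in_alg K) p.
  apply/polyP => i; rewrite coef_map coef_poly /=.
  by case: ltnP => [_|/(nth_default 0) ->]; rewrite ?rE // scale0r.
have [q [a a0 pq]] := rat_poly_scale p.
have FqE i : F`_i = a%:~R^-1 * (q`_i)%:~R.
  rewrite FE pq coef_map coefZ coef_map.
  pose iota : {rmorphism rat -> K} := in_alg K.
  rewrite -[LHS]/(iota (a%:~R^-1 * (q`_i)%:~R)).
  by rewrite rmorphM fmorphV !rmorph_int.
pose d := zcontents q; exists (a%:~R^-1 * d%:~R).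
have a0' : a%:~R != 0 :> K.
  by rewrite -(rmorph_int (in_alg K)) fmorph_eq0 intr_eq0.
have d0 : d != 0.
  apply: contra_neq F0 => /eqP; rewrite zcontents_eq0 => /eqP q0.
  by apply/polyP => i; rewrite FqE q0 !coef0 mulr0.
have d0' : d%:~R != 0 :> K.
  by rewrite -(rmorph_int (in_alg K)) fmorph_eq0 intr_eq0.
split=> [||i]; first by rewrite mulf_neq0 ?invr_eq0.
  apply: (zcontents_mem (N := fun z => J (a%:~R^-1 * z%:~R))) => [|x y|z x|i].
  - by rewrite mulr0.
  - by rewrite rmorphD mulrDr; apply: JD.
  - rewrite rmorphM mulrCA; apply: JZ.
    exact: (integral_id (intr : {rmorphism int -> K})).
  - by rewrite -FqE.
have qE : q = d *: zprimitive q by rewrite -zpolyEprim.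
clearbody d; rewrite coefZ FqE [in q`_i]qE coefZ intrM invfM invrK mulrACA.
rewrite mulfV // mul1r mulrA mulVf // mul1r.
exact: (integral_id (intr : {rmorphism int -> K})).
Qed.

(** * Conjugation by an automorphism of finite order with fixed field the rationals *)

Section Conjugates.
Variables (sigma : {rmorphism K -> K}) (n : nat).
Hypothesis n_gt0 : (0 < n)%N.
Hypothesis sigmaK : iter n sigma =1 id.
Hypothesis fixed_rat : forall x, sigma x = x -> exists q : rat, x = q%:A.

Definition conj_ideal (I : set K) : set K := sigma @` I.

Lemma conj_integers x : O x -> O (sigma x).
Proof.
move=> /(integral_rmorph sigma) [p monp rp]; exists p => //.
by move: rp; rewrite (eq_map_poly (g := intr)) // => a; apply: rmorph_int.
Qed.

Lemma conj_integers_onto x : O x -> exists2 y, O y & sigma y = x.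
Proof.
move=> Ox; exists (iter n.-1 sigma x); last by rewrite -iterS prednK // sigmaK.
by elim: n.-1 => //= k; apply: conj_integers.
Qed.

Lemma conj_ideal_integers : conj_ideal O = O.
Proof.
rewrite eqEsubset; split=> [_ [x Ox <-]|x /conj_integers_onto[y Oy <-]].
  exact: conj_integers.
by exists y.
Qed.

Lemma conj_ideal_mul (I J : set K) :
  conj_ideal (ideal_mul I J) = ideal_mul (conj_ideal I) (conj_ideal J).
Proof.
rewrite eqEsubset; split.
  move=> _ [_ [s sP ->] <-]; rewrite rmorph_sum big_seq.
  apply: big_ind => [|x y|p /sP[Ip Jp]]; [exact: ideal_mul0|exact: ideal_mulD|].
  by rewrite rmorphM; apply: ideal_mul_gen; [exists p.1|exists p.2].
apply: ideal_mul_sub.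
- by exists 0; [exact: ideal_mul0|rewrite rmorph0].
- move=> _ _ [x Ix <-] [y Iy <-]; exists (x + y); last by rewrite rmorphD.
  exact: ideal_mulD.
- move=> _ _ [x Ix <-] [y Iy <-]; exists (x * y); last by rewrite rmorphM.
  exact: ideal_mul_gen.
Qed.

Lemma conj_fractional (I : set K) :
  fractional_ideal I -> fractional_ideal (conj_ideal I).
Proof.
move=> [I0 ID IZ [x Ix x0] [d [Od d0 dI]]]; split.
- by exists 0; rewrite ?rmorph0.
- by move=> _ _ [y Iy <-] [z Iz <-]; exists (y + z);
    rewrite ?rmorphD //; apply: ID.
- move=> _ _ /conj_integers_onto[a Oa <-] [y Iy <-].
  by exists (a * y); rewrite ?rmorphM //; apply: IZ.
- by exists (sigma x); [exists x|rewrite fmorph_eq0].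
- exists (sigma d); split; [exact: conj_integers|by rewrite fmorph_eq0|].
  by move=> _ [y Iy <-]; rewrite -rmorphM; apply: conj_integers; apply: dI.
Qed.

Lemma conj_invertible (I : set K) :
  invertible_ideal I -> invertible_ideal (conj_ideal I).
Proof.
move=> [fI [J fJ IJ]]; split; first exact: conj_fractional.
exists (conj_ideal J); first exact: conj_fractional.
by rewrite -conj_ideal_mul IJ conj_ideal_integers.
Qed.

Lemma conj_content (f : {poly K}) (I : set K) :
  content_ideal f I -> content_ideal (map_poly sigma f) (conj_ideal I).
Proof.
move=> [fI Imin]; split=> [i|J [J0 JD JZ] fJ].
  by rewrite coef_map; exists f`_i.
move=> _ [x Ix <-]; apply: (Imin [set y | J (sigma y)]) Ix => [|i].
  split=> [|y z|a y Oa] /=; rewrite ?rmorph0 ?rmorphD ?rmorphM //.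
    exact: JD.
  by apply: JZ; apply: conj_integers.
by rewrite /= -coef_map.
Qed.

(* By Gauss's lemma for contents, the norm of I is the content of the norm of
   a polynomial with content I, and that norm has rational coefficients. *)
Lemma ideal_norm_principal (I : set K) : invertible_ideal I ->
  exists2 c, c != 0 &
    ideal_prod [seq iter i conj_ideal I | i <- iota 0 n] = ideal_scale c O.
Proof.
move=> invI; have [f f0 fI] := invertible_content invI.
pose G i := iter i (map_poly sigma) f; pose C i := iter i conj_ideal I.
pose s := [seq (G i, C i) | i <- iota 0 n].
have GC i : content_ideal (G i) (C i).
  by elim: i => [//|i IHi]; apply: conj_content.
have Cf i : fractional_ideal (C i).
  by elim: i => [|i IHi]; [case: invI|exact: conj_fractional].
have sP p : p \in s -> content_ideal p.1 p.2 by move=> /mapP[i _ ->]; exact: GC.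
have -> : [seq iter i conj_ideal I | i <- iota 0 n] = map snd s.
  by rewrite -map_comp.
set F := \prod_(p <- s) p.1.
have FE : F = \prod_(0 <= i < n) G i by rewrite /F big_map /index_iota subn0.
have Gn0 : G n = f.
  apply/polyP => j; rewrite /G -[RHS]sigmaK; elim: n => //= k IHk.
  by rewrite coef_map IHk.
(* Both [f] times the conjugate of [F] and [F] times [G n] are the product of [G 0, ..., G n], and
   [G n = f]. *)
have sF : map_poly sigma F = F.
  apply: (mulfI f0); rewrite {2}FE -{2}Gn0 mulrC [RHS]mulrC.
  rewrite -big_nat_recr //= big_nat_recl // mulrC; congr (_ * _).
  by rewrite FE rmorph_prod.
have F0 : F != 0.
  rewrite FE prodf_seq_neq0; apply/allP => i _ /=; elim: i => //= k.
  by rewrite map_poly_eq0.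
have fP : fractional_ideal (ideal_prod (map snd s)).
  by apply: fractional_prod => J /mapP[p /mapP[i _ ->] ->]; exact: Cf.
have [|||c [c0 Pc Oc]] := @rational_poly_content F (ideal_prod (map snd s)) F0.
- by move=> i; apply: fixed_rat; rewrite -{2}sF coef_map.
- exact: fractional_submodule.
- exact: content_prod_coef.
(* As [c^-1 F] has integral coefficients, [content_prod_sub] puts the product of the ideals inside
   [c O]; conversely [c] lies in that product. *)
exists c => //; rewrite eqEsubset; split=> [x Px|_ [x Ox <-]].
  exists (c^-1 * x); last by rewrite mulVKf.
  exact: content_prod_sub Px.
by rewrite mulrC; case: fP => _ _ PZ _ _; apply: PZ.
Qed.

Lemma iter_conj_ideal (I : set K) : iter n conj_ideal I = I.
Proof.
have iterE k : iter k conj_ideal I = iter k sigma @` I.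
  elim: k => [|k /= ->]; first exact/esym/image_id.
  by rewrite /conj_ideal image_comp.
rewrite iterE (_ : iter n sigma = id); first exact: image_id.
exact/funext.
Qed.

Definition conj_ideal_group (I : ideal_group K) : ideal_group K :=
  IdealGroup (asboolT (conj_invertible (ideal_groupP I))).

Definition conj_class (c : class_group K) : class_group K :=
  ideal_class (conj_ideal_group (generic_quotient.repr c)).

(** Independence of the representative: the conjugate of [a I] is [sigma a] times the conjugate of
    [I]. *)
Lemma conj_classE (I : ideal_group K) :
  conj_class (ideal_class I) = ideal_class (conj_ideal_group I).
Proof.
have /ideal_class_eq[a a0 aI] := ideal_classK (ideal_class I).
apply/ideal_class_eq; exists (sigma a); first by rewrite fmorph_eq0.
rewrite /= aI /conj_ideal eqEsubset; split.
  by move=> _ [_ [x Ix <-] <-]; exists (sigma x); [exists x|rewrite rmorphM].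
by move=> _ [_ [x Ix <-] <-]; exists (a * x); [exists x|rewrite rmorphM].
Qed.

Lemma conj_classM (c d : class_group K) :
  conj_class (c * d)%g = (conj_class c * conj_class d)%g.
Proof.
rewrite -(ideal_classK c) -(ideal_classK d).
rewrite -[(_ * _)%g in LHS]/(class_mul _ _) -[RHS]/(class_mul _ _).
rewrite class_mulE !conj_classE class_mulE; congr ideal_class.
by apply: val_inj; apply: conj_ideal_mul.
Qed.

Lemma iter_conj_class k (I : ideal_group K) :
  iter k conj_class (ideal_class I) = ideal_class (iter k conj_ideal_group I).
Proof. by elim: k => //= k ->; rewrite conj_classE. Qed.

Lemma conj_ideal_group_iter k (I : ideal_group K) :
  ideal_set (iter k conj_ideal_group I) = iter k conj_ideal I.
Proof. by elim: k => //= k ->. Qed.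

Lemma iter_conj_class_id (c : class_group K) : iter n conj_class c = c.
Proof.
rewrite -(ideal_classK c) iter_conj_class; congr ideal_class.
by apply: val_inj; rewrite /= conj_ideal_group_iter iter_conj_ideal.
Qed.

(** All conjugates of an ideal in a fixed class lie in that class, so [c ^+ n] is the class of their
    product, which is principal by [ideal_norm_principal]. *)
Lemma conj_class_fixed (c : class_group K) :
  conj_class c = c -> (c ^+ n = 1)%g.
Proof.
move=> fix_c; set I := generic_quotient.repr c.
have [a a0 Na] := ideal_norm_principal (ideal_groupP I).
(* The product is rebuilt in the ideal group, so that its class can be computed along with it. *)
have prodE t : exists2 J : ideal_group K,
    ideal_set J = ideal_prod [seq iter i conj_ideal I | i <- t] &
    ideal_class J = (c ^+ size t)%g.
  elim: t => [|i t [J JE Jc]] /=; first by exists 1%g.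
  exists (iter i conj_ideal_group I * J)%g.
    by rewrite /= conj_ideal_group_iter JE.
  rewrite -class_mulE -iter_conj_class ideal_classK Jc expgS.
  by rewrite (_ : iter i _ c = c) //; elim: i => //= i ->.
have [J JE Jc] := prodE (iota 0 n); rewrite size_iota in Jc.
rewrite -Jc; apply/ideal_class_eq; exists a => //.
by rewrite JE Na.
Qed.

End Conjugates.
End IdealNorm.

(** * Fixed-point-free automorphisms of elementary abelian groups *)

Lemma mult_order_dvd (a q d : nat) :
  (1 < q)%N -> (0 < d)%N -> a ^ d = 1 %[mod q] -> (mult_order a q %| d)%N.
Proof.
move=> q1 d0 ad; have natr_ad : ((a ^ d)%:R = 1 :> 'Z_q)%R.
  by rewrite -(Zp_nat_mod q1) ad Zp_nat_mod.
(* A power of [a] with positive exponent is [1], so [a] is a unit and [insubd] does not return its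
   default. *)
have ua : (a%:R : 'Z_q) \is a GRing.unit.
  by rewrite -(unitrX_pos _ d0) -natrX natr_ad unitr1.
rewrite order_dvdn; apply/eqP/val_inj.
by rewrite FinRing.val_unitX insubdK // -natrX natr_ad.
Qed.

Lemma min_mult_order_le (a n q : nat) :
  q \in primes n -> (min_mult_order a n <= mult_order a q)%N.
Proof.
rewrite /min_mult_order; elim: (primes n) => // p s IHs; rewrite inE big_cons.
case/predU1P => [->|/IHs]; first exact: geq_minl.
exact/leq_trans/geq_minr.
Qed.

Section FixedPointFree.
Local Open Scope group_scope.
Variables (gT : finGroupType) (E : {group gT}) (s : {perm gT}) (l n : nat).
Hypothesis l_abelem : l.-abelem E.
Hypothesis E_neq1 : E :!=: 1.
Hypothesis sM : {morph s : x y / x * y}.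
Hypothesis sE : forall x, x \in E -> s x \in E.
Hypothesis s_fix : forall x, x \in E -> s x = x -> x = 1.
Hypothesis n_gt0 : (0 < n)%N.
Hypothesis sn : s ^+ n = 1.

Lemma perm_expgM k : {morph s ^+ k : x y / x * y}.
Proof.
elim: k => [|k IHk] x y; first by rewrite !perm1.
by rewrite expgSr !permM IHk sM.
Qed.

Lemma perm_expg_stable k x : x \in E -> (s ^+ k) x \in E.
Proof. by elim: k => [|k IHk] Ex; rewrite ?perm1 // expgSr permM sE ?IHk. Qed.

Definition fixed_points k := [set x in E | (s ^+ k) x == x].

Lemma fixed_points_group_set k : group_set (fixed_points k).
Proof.
apply/group_setP; split=> [|x y].
  rewrite inE group1 /=; apply/eqP/(mulgI ((s ^+ k) 1)).
  by rewrite -perm_expgM !mulg1.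
rewrite !inE => /andP[Ex /eqP fx] /andP[Ey /eqP fy].
by rewrite groupM // perm_expgM fx fy eqxx.
Qed.

Canonical fixed_points_group k := Group (fixed_points_group_set k).

(* Take m minimal among the divisors of n such that s^m fixes a nontrivial
   point: for a prime q | m, the power s^(m/q) acts on the fixed points of s^m
   with order q and without nontrivial fixed points. *)
Lemma fixed_point_free_abelem : exists2 B : {group gT},
  B \subset E & (min_mult_order l n <= logn l #|B|)%N.
Proof.
pose P k := [&& (0 < k)%N, (k %| n)%N & fixed_points k != 1].
have exP : exists k, P k.
  exists n; rewrite /P n_gt0 dvdnn /=.
  rewrite (_ : fixed_points n = E) //; apply/setP => x.
  by rewrite inE sn perm1 eqxx andbT.
case: (ex_minnP exP) => m /and3P[m_gt0 m_dvd_n B_neq1] m_min.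
have m_gt1 : (1 < m)%N.
  rewrite ltn_neqAle m_gt0 andbT; apply: contraNneq B_neq1 => <-.
  apply/eqP/setP => x; rewrite inE expg1.
  apply/andP/set1gP => [[Ex /eqP sx]|->]; first exact: s_fix.
  by have := group1 (fixed_points_group 1); rewrite inE expg1 => /andP.
pose q := pdiv m; have q_pr : prime q by apply: pdiv_prime.
have q_dvd_m : (q %| m)%N by apply: pdiv_dvd.
have [k kq] : exists k, (k * q = m)%N by exists (m %/ q)%N; rewrite divnK.
pose B := fixed_points_group m.
have k_gt0 : (0 < k)%N by rewrite -(ltn_pmul2r (prime_gt0 q_pr)) kq.
(* As [k < m] also divides [n], minimality of [m] leaves only the trivial fixed point. *)
have fix_k : fixed_points k = 1.
  apply/eqP; apply: contraTT (ltn_Pmulr (prime_gt1 q_pr) k_gt0) => fk.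
  rewrite kq -leqNgt m_min // /P k_gt0 fk andbT (dvdn_trans _ m_dvd_n) //.
  by rewrite -kq dvdn_mulr.
have NB j : s ^+ j \in 'N(B | 'P).
  rewrite !inE /=; apply/fintype.subsetP => x /[!inE] /andP[Ex /eqP fx].
  rewrite /= /aperm perm_expg_stable //= -permM -expgD addnC expgD permM fx.
  exact: eqxx.
pose r := restr_perm B (s ^+ k).
have rq : r ^+ q = 1.
  rewrite -morphX ?NB // -expgM kq; apply/permP => x; rewrite perm1.
  have [Bx|nBx] := boolP (x \in B); last exact: (out_perm (restr_perm_on _ _)).
  by rewrite restr_permE ?NB //; move: Bx; rewrite inE => /andP[_ /eqP].
have q_group : q.-group <[r]>.
  apply: (@pnat_dvd _ q); last exact: pnat_id.
  by rewrite -orderE order_dvdn rq.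
have actsB : [acts <[r]>, on B | 'P].
  rewrite cycle_subG !inE /=; apply/fintype.subsetP => x Bx.
  by rewrite inE /= /aperm perm_closed ?restr_perm_on.
(* For a [q]-group acting on [B], the number of fixed points is congruent to [#|B|] modulo [q]; here
   [1] is the only one. *)
have := pgroup_fix_mod q_group actsB.
have -> : 'Fix_(B | 'P)(<[r]>) = 1.
  apply/setP => x; rewrite inE.
  apply/andP/set1gP => [[Bx /afixP fx]|->].
    have := fx r (cycle_id r); rewrite /= /aperm restr_permE ?NB // => fkx.
    apply/set1gP; rewrite -fix_k inE fkx eqxx andbT.
    by move: Bx; rewrite inE => /andP[].
  split; first exact: group1.
  apply/afixP => a /cycleP[i ->] /=; rewrite /aperm.
  suff r1 : r 1 = 1 by elim: i => [|i IHi]; rewrite ?perm1 // expgSr permM IHi.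
  rewrite restr_permE ?NB ?group1 //.
  by apply: (mulgI ((s ^+ k) 1)); rewrite -perm_expgM !mulg1.
rewrite cards1.
have sBE : B \subset E by apply/fintype.subsetP => x; rewrite inE => /andP[].
have /abelem_pgroup lB := abelemS sBE l_abelem.
have Bcard : (#|B| = l ^ logn l #|B|)%N by rewrite -p_part part_pnat_id.
rewrite [in LHS]Bcard => B1; exists B => //.
have d_gt0 : (0 < logn l #|B|)%N.
  rewrite lt0n; apply: contraNneq B_neq1 => d0.
  by rewrite -[fixed_points m]/(gval B) trivg_card1 Bcard d0.
have q_n : q \in primes n by rewrite mem_primes q_pr n_gt0 (dvdn_trans q_dvd_m).
apply: leq_trans (min_mult_order_le l q_n) (dvdn_leq d_gt0 _).
by apply: mult_order_dvd; rewrite ?prime_gt1.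
Qed.

End FixedPointFree.

Lemma abelem_rV_embedding (gT : finGroupType) (E : {group gT}) (l d : nat) :
  prime l -> (l.-abelem E)%g -> (d <= logn l #|E|)%N ->
  exists f : 'rV['Z_l]_d -> gT,
    [/\ {morph f : x y / x + y >-> (x * y)%g}, injective f
      & forall x, f x \in E].
Proof.
(* The coordinates [rVabelem] require a nontrivial group; for the trivial one [d = 0]. *)
move=> l_pr abelE; have [E1|E_neq1] := eqVneq (gval E) 1%g.
  rewrite E1 cards1 logn1 leqn0 => /eqP d0; exists (fun=> 1%g).
  split=> [x y|x y _|x]; rewrite ?mulg1 ?group1 //.
  by subst d; rewrite thinmx0 [y]thinmx0.
rewrite -(dim_abelemE abelE E_neq1) => dE.
(* ['F_l] is ['Z_(pdiv l)], and [pdiv l = l] for prime [l]. *)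
suff: exists f : 'rV['F_l]_d -> gT,
    [/\ {morph f : x y / x + y >-> (x * y)%g}, injective f
      & forall x, f x \in E] by rewrite (pdiv_id l_pr).
(* Multiplication by [pid_mx d] pads a row with zeros up to the dimension of [E]; the opposite
   truncation is a left inverse because [d] is at most that dimension. *)
exists (fun u => rVabelem abelE E_neq1 (u *m pid_mx d)); split.
- by move=> x y; rewrite mulmxDl rVabelemD.
- apply: (can_inj (g := fun x => abelem_rV abelE E_neq1 x *m pid_mx d)) => u.
  by rewrite rVabelemK -mulmxA mul_pid_mx minnn (minn_idPr dE) pid_mx_1 mulmx1.
- by move=> x; apply: mem_rVabelem.
Qed.

(** The group [E] of elements killed by [l] is elementary abelian and, by Cauchy's theorem,
    nontrivial. An element of [E] fixed by [phi] is killed by both [l] and [n], which are coprime,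
    hence is trivial. *)
Lemma fixed_point_free_torsion (gT : finGroupType) (phi : gT -> gT)
  (l n : nat) :
  commutative (@mulg gT) -> {morph phi : x y / (x * y)%g} ->
  iter n phi =1 id -> (forall x, phi x = x -> x ^+ n = 1)%g ->
  prime l -> ~~ (l %| n)%N -> (l %| #|gT|)%N ->
  exists f : 'rV['Z_l]_(min_mult_order l n) -> gT,
    [/\ {morph f : x y / x + y >-> (x * y)%g}, injective f
      & forall x, (f x ^+ l = 1)%g].
Proof.
move=> mulC phiM phi_n fixn l_pr l_ndvd l_dvd.
have n_gt0 : (0 < n)%N by case: (n) l_ndvd => //; rewrite dvdn0.
have phi_inj : injective phi.
  by move=> x y xy; rewrite -[x]phi_n -[y]phi_n -(prednK n_gt0) !iterSr xy.
pose s := perm phi_inj.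
have gE : group_set (finset (fun x : gT => x ^+ l == 1)%g).
  apply/group_setP; split=> [|x y]; rewrite !inE ?expg1n // => /eqP xl /eqP yl.
  by rewrite expgMn ?xl ?yl ?mulg1 //; apply: mulC.
pose E := Group gE.
have abelE : (l.-abelem E)%g.
  apply/abelemP => //; split; last by move=> x; rewrite inE => /eqP.
  by apply/centsP => x _ y _; apply: mulC.
have E_neq1 : E :!=: 1%g.
  have [|x _ ox] := @Cauchy gT l [set: gT]%G l_pr; first by rewrite cardsT.
  apply/eqP => E1; have : x \in E by rewrite inE -ox expg_order.
  by rewrite E1 => /set1gP x1; move: l_pr; rewrite -ox x1 order1.
have sM : {morph s : x y / (x * y)%g} by move=> x y; rewrite !permE phiM.
have phiX x k : phi (x ^+ k)%g = (phi x ^+ k)%g.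
  have phi1 : phi 1%g = 1%g by apply: (mulgI (phi 1%g)); rewrite -phiM !mulg1.
  by elim: k => [|k IHk]; rewrite ?expg0 // !expgS phiM IHk.
have [|||B sBE dB] := fixed_point_free_abelem abelE E_neq1 sM _ _ n_gt0.
- by move=> x; rewrite !inE permE -phiX => /eqP ->; rewrite -(expg0 x) phiX.
- move=> x; rewrite inE permE => /eqP xl /fixn xn.
  apply/eqP; rewrite -order_eq1 -dvdn1 -(eqP (_ : coprime l n)).
    by rewrite dvdn_gcd !order_dvdn xl xn eqxx.
  by rewrite prime_coprime.
- apply/permP => x; rewrite perm1 -[RHS]phi_n.
  have sk k : (s ^+ k)%g x = iter k phi x.
    by elim: k => [|k IHk]; rewrite ?perm1 // expgSr permM IHk permE.
  exact: sk.
have [f [fD f_inj fB]] := abelem_rV_embedding l_pr (abelemS sBE abelE) dB.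
exists f; split=> // x.
by have /(fintype.subsetP sBE) := fB x; rewrite inE => /eqP.
Qed.

(** * Finite group structure on a group that injects into a finite type *)

Section FiniteGroupOf.
Variables (G : groupType) (T : finType) (f : G -> T) (g : T -> G).

(* The proof fK only serves as the key of the finite structure. *)
Definition fin_group_of (fK : cancel f g) : Type := G.

Variable fK : cancel f g.
HB.instance Definition _ := Group.on (fin_group_of fK).
HB.instance Definition _ : isCountable (fin_group_of fK) := CanIsCountable fK.
HB.instance Definition _ : isFinite (fin_group_of fK) :=
  CanIsFinite (fK : @cancel T (fin_group_of fK) f g).

End FiniteGroupOf.

(* The class group of a cyclic extension *)
Local Close Scope ring_scope.

Theorem theorem1p5 (K : splittingFieldType rat) (n l h : nat)
  (galK : galois 1 {:K}) (cycK : cyclic 'Gal({:K} / 1))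
  (dimK : \dim {:K} = n)
  (l_prime : prime l) (l_ndvd_n : ~~ (l %| n))
  (hK : has_class_number K h) (l_dvd_h : l %| h) :
  exists H : set (class_group K),
    [/\ is_subgroup H,
        H `<=` torsion (class_group K) l
      & isomorphic_to_additive H 'rV['Z_l]_(min_mult_order l n)].
Proof.
have n_gt0 : (0 < n)%N by case: (n) l_ndvd_n => //; rewrite dvdn0.
have [x GalE] := cyclicP cycK.
pose sigma : {rmorphism K -> K} := x.
have sigma_iter k : iter k sigma =1 (x ^+ k)%g.
  move=> a; elim: k => [|k IHk]; first by rewrite expg0 gal_id.
  by rewrite expgSr galM ?memvf //= IHk.
have sigmaK : iter n sigma =1 id.
  move=> a; rewrite sigma_iter (_ : x ^+ n = 1)%g ?gal_id //.
  by have := galois_dim galK; rewrite dimv1 divn1 dimK GalE => ->;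
    rewrite expg_order.
(* An element fixed by the generator is fixed by the whole Galois group, hence lies in the base
   field. *)
have fixed_rat a : sigma a = a -> exists q : rat, a = q%:A%R.
  move=> fa; suff: a \in 1%VS by case/vlineP => q ->; exists q.
  rewrite -(galois_fixedField galK); apply/fixedFieldP; first exact: memvf.
  move=> y; rewrite GalE => /cycleP[k ->]; rewrite -sigma_iter.
  by elim: k => //= k ->.
(* The bijection provided by the class number turns the class group into a finite group of order
   [h]. *)
have [F [F_lt F_inj F_surj]] := card_set_bijP hK.
have F_onto (i : 'I_h) : exists c, F c = i.
  by have [|c _ <-] := F_surj i; [exact: ltn_ord|exists c].
have [g gP] := choice F_onto.
pose f c : 'I_h := Ordinal (F_lt c I).
have fK : cancel f g by move=> c; apply: F_inj; rewrite ?in_setE // gP.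
have gK : cancel g f by move=> i; apply: val_inj; rewrite /= gP.
have card_h : #|{: fin_group_of fK}| = h.
  rewrite -[RHS]card_ord; apply: (bij_eq_card (f := f : fin_group_of fK -> _)).
  by exists g.
have [|||||||u [uD u_inj ul]] :=
  @fixed_point_free_torsion (fin_group_of fK)
    (@conj_class K sigma n n_gt0 sigmaK) l n.
- exact: class_mulC.
- exact: conj_classM.
- exact: iter_conj_class_id.
- exact: conj_class_fixed.
- by [].
- by [].
- by rewrite card_h.
have u0 : u 0%R = 1%g.
  by apply: (mulgI (u 0%R)); rewrite -uD addr0 mulg1.
exists (range u); split.
- split; first by exists 0%R.
  move=> _ _ [a _ <-] [b _ <-]; exists (a - b)%R => //.
  by apply: (mulIg (u b)); rewrite mulgKV -uD subrK.
- by move=> _ [a _ <-]; exact: ul.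
- exists u => //; split;
    [by move=> a _; exists a|by move=> a b _ _; exact: u_inj|].
  by move=> c.
Qed.
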